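(* Let $\lambda\in(-1,1)$, let $n\ge1$ be an integer, and let $\mathbf x=(x_1,\dots,x_n)\in\Delta^n$. Then $\sigma=\Sigma_n(\mathbf x)$ satisfies $\langle p,\sigma-\lambda\rangle=0$ for every real polynomial $p$ of degree at most $n-1$ if and only if $x_1,\dots,x_n$ are the roots, listed in increasing order, of the following two polynomials in $x$ taken together: - if $n=2m$: $P_m(x,\theta)$ and $P_m(x,-\theta)$, where $\theta=\frac{1-\lambda}{2}$; - if $n=2m+1$: $Q_{m+1}(x,\theta)$ and $R_m(x,-\theta)$, where $\theta=\frac{1+\lambda}{2}$. In each case $x_n,x_{n-2},x_{n-4},\dots$ are the roots of the first of the two polynomials (and the remaining $x_i$ are the roots of the second).
   Context: For $f\in L^1[0,1]$ and $g\in L^\infty[0,1]$, $\langle f,g\rangle=\int_0^1 g(t)f(t)\,dt$. Let $\Delta^n=\{\mathbf x\in\mathbb R^n\mid 0\le x_1\le x_2\le\dots\le x_n\le 1\}$, and put $x_0=0$, $x_{n+1}=1$. For $\mathbf x\in\Delta^n$, $\Sigma_n(\mathbf x)\in L^\infty[0,1]$ is the class of the function with $\Sigma_n(\mathbf x)(t)=(-1)^m$ for $x_m\le t<x_{m+1}$ ($0\le m\le n$) and $\Sigma_n(\mathbf x)(1)=(-1)^n$. With generalized binomial coefficients $\binom{t}{i}=t(t-1)\cdots(t-i+1)/i!$, for integers $m\ge0$ define $$P_m(x,\theta)=\sum_{i=0}^m(-1)^i\frac{m!\,(2m-i)!}{(2m)!\,(m-i)!}\binom{m+\theta}{i}x^{m-i},$$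 $$Q_{m+1}(x,\theta)=\sum_{i=0}^{m+1}(-1)^i\frac{(m+1)!\,(2m+1-i)!}{(2m+1)!\,(m+1-i)!}\binom{m+\theta}{i}x^{m+1-i},$$ $$R_m(x,\theta)=\sum_{i=0}^m(-1)^i\frac{m!\,(2m+1-i)!}{(2m+1)!\,(m-i)!}\binom{m+1+\theta}{i}x^{m-i}.$$ *)

(* Defs.v *)
From HB Require Import structures.
From mathcomp Require Import all_boot all_order all_algebra.
From mathcomp Require Import all_classical all_reals all_analysis.

Set Implicit Arguments.
Unset Strict Implicit.
Unset Printing Implicit Defensive.
Import Order.TTheory GRing.Theory Num.Theory.
Import numFieldNormedType.Exports.
Local Open Scope classical_set_scope.
Local Open Scope ring_scope.

(* Elements of L^1[0,1] and L^oo[0,1] are given by representatives: the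
   integral depends only on their classes modulo equality a.e. *)
Definition pairing (R : realType) (f g : R -> R) : R :=
  \int[@lebesgue_measure R]_(t in `[0, 1]) (g t * f t).

Definition Delta (R : realType) (n : nat) : set (n.-tuple R) :=
  [set x | path <=%R 0 (rcons x 1)].

(* 1-based: node x 0 = 0, node x i = x_i for 1 <= i <= n, node x n.+1 = 1. *)
Definition node (R : realType) (n : nat) (x : n.-tuple R) (i : nat) : R :=
  nth 1 (0 :: x) i.

Definition Sigma (R : realType) (n : nat) (x : n.-tuple R) (t : R) : R :=
  (\sum_(m < n.+1) (-1) ^+ m * \1_(`[node x m, node x m.+1[) t)
  + (-1) ^+ n * \1_[set 1] t.

Definition gbin (R : realType) (t : R) (i : nat) : R :=
  (\prod_(j < i) (t - j%:R)) / (i`!)%:R.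

Definition Ppoly (R : realType) (m : nat) (theta : R) : {poly R} :=
  \sum_(i < m.+1)
    ((-1) ^+ i * ((m`! * (2 * m - i)`!)%:R / ((2 * m)`! * (m - i)`!)%:R)
       * gbin (m%:R + theta) i) *: 'X^(m - i).

(* Qpoly m is Q_{m+1}. *)
Definition Qpoly (R : realType) (m : nat) (theta : R) : {poly R} :=
  \sum_(i < m.+2)
    ((-1) ^+ i * ((m.+1`! * (2 * m + 1 - i)`!)%:R
                  / ((2 * m + 1)`! * (m + 1 - i)`!)%:R)
       * gbin (m%:R + theta) i) *: 'X^(m + 1 - i).

Definition Rpoly (R : realType) (m : nat) (theta : R) : {poly R} :=
  \sum_(i < m.+1)
    ((-1) ^+ i * ((m`! * (2 * m + 1 - i)`!)%:R
                  / ((2 * m + 1)`! * (m - i)`!)%:R)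
       * gbin ((m + 1)%:R + theta) i) *: 'X^(m - i).

(* s lists all the roots of p, with multiplicity, and p splits over R. *)
Definition roots_of (R : realType) (p : {poly R}) (s : seq R) : Prop :=
  p %= \prod_(a <- s) ('X - a%:P).

Definition joint_roots (R : realType) (p q : {poly R}) (s : seq R) : Prop :=
  exists sp sq : seq R,
    [/\ roots_of p sp, roots_of q sq & s = sort <=%R (sp ++ sq)].

(* x_n, x_{n-2}, x_{n-4}, ... down to x_1 or x_2, and the remaining x_i. *)
Definition nodes_even (R : realType) (n : nat) (x : n.-tuple R) : seq R :=
  [seq node x i | i <- iota 1 n & ~~ odd (n - i)].

Definition nodes_odd (R : realType) (n : nat) (x : n.-tuple R) : seq R :=
  [seq node x i | i <- iota 1 n & odd (n - i)].

Lemma node_le (R : realType) (n : nat) (x : n.-tuple R) (i j : nat) :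
  Delta x -> (i <= j <= n.+1)%N -> node x i <= node x j.
Proof.
move=> xD /andP[ij jn].
have node_rcons k : node x k = nth 1 (0 :: rcons x 1) k.
  rewrite /node; case: k => [//|k] /=; rewrite nth_rcons size_tuple.
  case: ltnP => // nk; rewrite nth_default ?size_tuple//.
  by case: ifP.
rewrite !node_rcons.
apply: (@sorted_leq_nth _ _ le_trans lexx 1 (0 :: rcons x 1)) => //.
  by rewrite inE /= size_rcons size_tuple (leq_ltn_trans ij).
by rewrite inE /= size_rcons size_tuple.
Qed.

Lemma SigmaE (R : realType) (n m : nat) (x : n.-tuple R) (t : R) :
  Delta x -> (m <= n)%N -> node x m <= t < node x m.+1 ->
  Sigma x t = (-1) ^+ m.
Proof.
move=> xD mn /andP[mt tm]; rewrite /Sigma.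
have nodeS : node x n.+1 = 1 by rewrite /node /= nth_default// size_tuple.
have t1 : t < 1 by rewrite -nodeS (lt_le_trans tm)// node_le// ltnS mn /=.
have mn1 : (m < n.+1)%N by rewrite ltnS.
rewrite (bigD1 (Ordinal mn1))//= big1 ?addr0 => [|i im].
  rewrite !indicE !mem_setE in_itv/= mt tm mulr1.
  rewrite (_ : _ \in _ = false) ?mulr0 ?addr0//.
  by apply/negbTE/negP; rewrite inE => /= t1E; rewrite t1E ltxx in t1.
rewrite indicE mem_setE in_itv/=; case: andP; last by rewrite mulr0.
case=> it ti; have : (i != m :> nat) by rewrite -val_eqE /= in im.
rewrite neq_ltn => /orP[lim|lmi].
  have im1 : node x i.+1 <= node x m by rewrite node_le// lim ltnW.
  by have := lt_le_trans ti (le_trans im1 mt); rewrite ltxx.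
have mi1 : node x m.+1 <= node x i by rewrite node_le// lmi ltnW.
by have := lt_le_trans tm (le_trans mi1 it); rewrite ltxx.
Qed.

Lemma Sigma1 (R : realType) (n : nat) (x : n.-tuple R) :
  Delta x -> Sigma x 1 = (-1) ^+ n.
Proof.
move=> xD; rewrite /Sigma big1 ?add0r => [|i _].
  by rewrite indicE mem_set// mulr1.
rewrite indicE mem_setE in_itv/=; case: andP; last by rewrite mulr0.
have nodeS : node x n.+1 = 1 by rewrite /node /= nth_default// size_tuple.
have i1 : node x i.+1 <= 1 by rewrite -nodeS node_le// ltn_ord leqnn.
by case=> _ /lt_le_trans /(_ i1); rewrite ltxx.
Qed.

(* Main.v *)
Require Import Defs.
From mathcomp Require Import all_boot all_order all_algebra.
From mathcomp Require Import all_classical all_reals all_analysis.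
From mathcomp Require Import ring lra zify.
Import Order.TTheory GRing.Theory Num.Theory.
Import numFieldNormedType.Exports.
Local Open Scope ring_scope.
Set Implicit Arguments.
Unset Strict Implicit.
Unset Printing Implicit Defensive.

(** Write A for the nodes x_n, x_(n-2), ... and B for the remaining ones, and
    put d = |A| - |B| and theta = (1 - (-1)^n lambda) / 2, which lies in
    ]0, 1[.  If q is an antiderivative of p, then <p, sigma - lambda> is an
    alternating sum of the increments of q between consecutive nodes, minus
    lambda (q(1) - q(0)); Abel summation turns its vanishing into

      sum_(a in A) (q(a) - q(0)) - sum_(b in B) (q(b) - q(0))
        = theta (q(1) - q(0)),

    so sigma - lambda is orthogonal to the polynomials of degree at most n - 1
    exactly when this holds for all q of degree at most n
    (orthogonal_balanced).  Call this the balance condition on (A, B); it makes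
    sense for any two lists of numbers, and three facts about it give the
    theorem.

    1. (balancedP)  The condition says that n + 1 successive moments of a
    weighted sum of n + 2 point masses (those at A, at B, at 0 and at 1)
    vanish.  These moments are the coefficients of the expansion at infinity of
    the rational function with these simple poles and residues.  Hence they
    vanish iff the numerator of that function is constant.  For the monic
    polynomials a and b with roots A and B the numerator is

      W = x (x - 1) (a' b - a b') - (d (x - 1) + theta) a b.

    In other words (a, b) is, up to reversal of the coefficients, a Pade
    approximant of (1 - z)^theta.

    2. (deriv_wronsk)  One computes W' = b L(a) - a L'(b), where L and L' are
    hypergeometric differential operators.  If W is constant and a, b are
    coprime, then a divides L(a), whose degree is smaller, so L(a) = 0;
    likewise L'(b) = 0.  Each equation is a two-term recurrence on the
    coefficients, whose only monic solution of the right degree is the explicit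
    polynomial of the theorem (pade_of_balanced).  Conversely, the explicit
    polynomials solve the equations, so W is constant for them
    (balanced_of_pade).

    3. (balanced_uniq, balanced_parity)  The balance condition forces the points
    of A and B, 0 and 1 to be distinct: otherwise some q of degree at most n
    vanishes at all of them except 1, and theta would be an integer.  When all
    points lie in [0, 1], testing with the polynomial that vanishes at 0 and at
    all points of A and B but y shows that y is in A iff the number of points
    above y is even.  Therefore the way in which the roots of the two
    polynomials are distributed among the x_i is determined by their order
    (balanced_nodes), which is what the converse implication needs. *)

(** * The explicit polynomials and their differential equation *)

(** The three families of the theorem are the cases (N, e) = (m, m), (m + 1, m)
    and (m, m + 1).  Reversing its coefficients gives the numerator of degree N
    in the Pade approximant of (1 - z)^theta with denominator of degree e. *)
Definition pade_poly (R : realType) (N e : nat) (theta : R) : {poly R} :=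
  \sum_(i < N.+1)
    ((-1) ^+ i * ((N`! * (N + e - i)`!)%:R / ((N + e)`! * (N - i)`!)%:R)
       * gbin (e%:R + theta) i) *: 'X^(N - i).

(** The operator x (x - 1) p'' + (beta x - gamma) p' - N (e + 1) p, whose last
    coefficient is the one for which a solution of degree N exists. *)
Definition hypergeom (R : realType) (N e : nat) (theta : R) (p : {poly R}) :=
  'X * ('X - 1) * p^`()^`()
  + (e%:R - N%:R + 2)%:P * 'X * p^`() - (e%:R + theta - N%:R + 1)%:P * p^`()
  - (N%:R * (e%:R + 1))%:P * p.

Lemma gbinS (R : realType) (t : R) i :
  gbin t i.+1 * i.+1%:R = gbin t i * (t - i%:R).
Proof.
rewrite /gbin big_ord_recr/= factS natrM.
have h : i.+1%:R != 0 :> R by rewrite pnatr_eq0.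
have h' : i`!%:R != 0 :> R by rewrite pnatr_eq0 -lt0n fact_gt0.
by field; rewrite h' addrC natr1.
Qed.

Lemma coef_pade_poly (R : realType) N e (theta : R) k : (k <= N)%N ->
  (pade_poly N e theta)`_k =
  (-1) ^+ (N - k) * ((N`! * (e + k)`!)%:R / ((N + e)`! * k`!)%:R)
    * gbin (e%:R + theta) (N - k).
Proof.
move=> kN; rewrite /pade_poly coef_sum.
have hi : (N - k < N.+1)%N by lia.
rewrite (bigD1 (Ordinal hi))//= big1 ?addr0 => [|i /eqP ik].
  rewrite coefZ coefXn subKn// eqxx mulr1.
  by rewrite (_ : N + e - (N - k) = e + k)%N//; lia.
rewrite coefZ coefXn; case: eqP => [kE|]; last by rewrite mulr0.
by case: ik; apply: val_inj => /=; have := ltn_ord i; lia.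
Qed.

Lemma size_pade_poly_le (R : realType) N e (theta : R) :
  (size (pade_poly N e theta) <= N.+1)%N.
Proof.
apply: (leq_trans (size_sum _ _ _)); apply/bigmax_leqP => i _.
by apply: (leq_trans (size_scale_leq _ _)); rewrite size_polyXn ltnS leq_subr.
Qed.

Lemma lead_coef_pade_poly (R : realType) N e (theta : R) :
  (pade_poly N e theta)`_N = 1.
Proof.
rewrite coef_pade_poly// subnn expr0 mul1r addnC mulnC /gbin big_ord0.
by rewrite divr1 mulr1 divff// pnatr_eq0 muln_eq0 -!lt0n negb_or -!lt0n !fact_gt0.
Qed.

Lemma size_pade_poly (R : realType) N e (theta : R) :
  size (pade_poly N e theta) = N.+1.
Proof.
apply/eqP; rewrite eqn_leq size_pade_poly_le ltnNge; apply/negP => h.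
have := lead_coef_pade_poly N e theta.
by rewrite nth_default// => /eqP; rewrite eq_sym oner_eq0.
Qed.

Lemma monic_pade_poly (R : realType) N e (theta : R) :
  pade_poly N e theta \is monic.
Proof. by rewrite monicE lead_coefE size_pade_poly lead_coef_pade_poly. Qed.

(** The operator couples only two neighbouring coefficients; the factor k - N
    is what lets the recurrence stop at degree N. *)
Lemma coef_hypergeom (R : realType) N e (theta : R) p k :
  (hypergeom N e theta p)`_k =
  (k%:R - N%:R) * (k%:R + e%:R + 1) * p`_k
  - (k%:R + 1) * (k%:R + 1 + e%:R + theta - N%:R) * p`_k.+1.
Proof.
have dE (q : {poly R}) i : q^`()`_i = i.+1%:R * q`_i.+1.
  by rewrite coef_deriv mulr_natl.
rewrite /hypergeom !coefB coefD.
rewrite -!mulrA mulrBl mul1r !coefXM !coefCM !coefXM !dE.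
by case: k => [|[|k]]/=; rewrite ?coefB ?coefXM ?dE/=; ring.
Qed.

Lemma hypergeom_pade_poly (R : realType) N e (theta : R) :
  hypergeom N e theta (pade_poly N e theta) = 0.
Proof.
apply/polyP => k; rewrite coef_hypergeom coef0.
have [kN|kN|->] := ltngtP k N.
- have [i NE] : exists i, N = (i + k.+1)%N by exists (N - k.+1)%N; lia.
  rewrite !coef_pade_poly//; last by lia.
  rewrite (_ : N - k = i.+1)%N; last by lia.
  rewrite (_ : N - k.+1 = i)%N; last by lia.
  rewrite addnS 2!factS !natrM exprS.
  have := gbinS (e%:R + theta) i.
  move: (gbin _ i.+1) (gbin _ i) => g1 g0 gE.
  have h1 : N`!%:R != 0 :> R by rewrite pnatr_eq0 -lt0n fact_gt0.
  have h2 : (N + e)`!%:R != 0 :> R by rewrite pnatr_eq0 -lt0n fact_gt0.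
  have h3 : k`!%:R != 0 :> R by rewrite pnatr_eq0 -lt0n fact_gt0.
  have h4 : k.+1%:R != 0 :> R by rewrite pnatr_eq0.
  have NER : N%:R = i%:R + k%:R + 1 :> R by rewrite NE addnS -natr1 natrD.
  move: (N`!) (N + e)%N`! (e + k)`! (k`!) h1 h2 h3 => n1 n2 n3 n4 h1 h2 h3.
  rewrite NER; set s := (-1) ^+ i; apply/eqP; rewrite subr_eq0; apply/eqP.
  transitivity (s * n1%:R * n3%:R / (n2%:R * n4%:R) * (k + e).+1%:R
    * (g1 * i.+1%:R)).
    by field; rewrite h2 h3.
  by rewrite gE; field; rewrite h2 h3 /= addrC natr1 h4.
- by rewrite !nth_default ?mulr0 ?subr0//;
    apply: leq_trans (size_pade_poly_le _ _ _) _ => //; apply: leq_trans kN _.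
- by rewrite subrr !mul0r add0r nth_default ?mulr0 ?oppr0// size_pade_poly_le.
Qed.

(** In the recurrence the factor of p`_k does not vanish for k < N, so the
    coefficients of a solution are determined downwards from that of X^N. *)
Lemma hypergeom_eq0_lead0 (R : realType) N e (theta : R) p :
  hypergeom N e theta p = 0 -> (size p <= N)%N -> p = 0.
Proof.
move=> L0 sp; suff p0 j k : (N <= k + j)%N -> p`_k = 0.
  by apply/polyP => k; rewrite coef0 (p0 N)// leq_addl.
elim: j k => [|j IH] k; first by rewrite addn0 => Nk; rewrite nth_default// (leq_trans sp).
have [Nk|kN] := leqP N k; first by rewrite nth_default// (leq_trans sp).
rewrite addnS -addSn => /IH pk1.
have := coef_hypergeom N e theta p k; rewrite L0 coef0 pk1 mulr0 subr0.
move/esym/eqP; rewrite !mulf_eq0 => /orP[/orP[]|/eqP//].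
  by rewrite subr_eq0 eqr_nat ltn_eqF.
by rewrite -natrD natr1 pnatr_eq0.
Qed.

Lemma hypergeom_monic_unique (R : realType) N e (theta : R) p :
  p \is monic -> size p = N.+1 -> hypergeom N e theta p = 0 ->
  p = pade_poly N e theta.
Proof.
move=> pm sp L0; apply/eqP; rewrite -subr_eq0; apply/eqP.
apply: (@hypergeom_eq0_lead0 _ N e theta).
  rewrite -[RHS](subrr (0 : {poly R})) -{1}L0 -(hypergeom_pade_poly N e theta).
  by rewrite /hypergeom !derivB; ring.
apply/leq_sizeP => k Nk; rewrite coefB; move: Nk; rewrite leq_eqVlt.
case/predU1P => [<-|Nk].
  by rewrite lead_coef_pade_poly -(monicP pm) lead_coefE sp subrr.
by rewrite !nth_default ?subrr ?sp// (leq_trans (size_pade_poly_le _ _ _)).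
Qed.

(** * Rational functions with simple poles and their moments *)

(** A list of pairs (w, y) stands for the sum of the fractions w / (X - y), that
    is, for the quotient of [pf_num] by [pf_den]. *)
Definition pf_den (R : comNzRingType) (s : seq (R * R)) : {poly R} :=
  \prod_(wy <- s) ('X - wy.2%:P).

Fixpoint pf_num (R : comNzRingType) (s : seq (R * R)) : {poly R} :=
  if s is wy :: s' then wy.1%:P * pf_den s' + ('X - wy.2%:P) * pf_num s' else 0.

Definition wsum (R : comNzRingType) (s : seq (R * R)) (q : {poly R}) : R :=
  \sum_(wy <- s) wy.1 * q.[wy.2].

Definition twist (R : comNzRingType) (j : nat) (s : seq (R * R)) :=
  [seq (wy.1 * wy.2 ^+ j, wy.2) | wy <- s].

Lemma pf_den_cons (R : comNzRingType) wy (s : seq (R * R)) :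
  pf_den (wy :: s) = ('X - wy.2%:P) * pf_den s.
Proof. exact: big_cons. Qed.

Lemma pf_den_twist (R : comNzRingType) j (s : seq (R * R)) :
  pf_den (twist j s) = pf_den s.
Proof. exact: big_map. Qed.

Lemma size_pf_den (R : comNzRingType) (s : seq (R * R)) : size (pf_den s) = (size s).+1.
Proof. by rewrite /pf_den size_prod_XsubC. Qed.

Lemma size_pf_num (R : idomainType) (s : seq (R * R)) :
  (size (pf_num s) <= size s)%N.
Proof.
elim: s => [|wy s IH]/=; first by rewrite size_poly0.
apply: leq_trans (size_polyD _ _) _; rewrite geq_max; apply/andP; split.
  by rewrite mul_polyC (leq_trans (size_scale_leq _ _))// size_pf_den.
apply: leq_trans (size_polyMleq _ _) _; rewrite size_XsubC/=.
exact: IH.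
Qed.

(** From X / (X - y) = y / (X - y) + 1: multiplication by X shifts the
    sequence of moments and splits off the first one. *)
Lemma mulX_pf_num_twist (R : comNzRingType) j (s : seq (R * R)) :
  'X * pf_num (twist j s) =
  pf_num (twist j.+1 s) + (wsum s 'X^j)%:P * pf_den s.
Proof.
elim: s => [|[w y] s IH]/=.
  by rewrite /wsum big_nil mulr0 add0r mul0r.
rewrite !pf_den_twist pf_den_cons /wsum big_cons/= -/(wsum s 'X^j) mulrDr.
rewrite [X in _ + X = _]mulrCA IH hornerXn exprS !polyCM !polyCD !polyCM.
ring.
Qed.

Lemma wsum_coef (R : comNzRingType) (s : seq (R * R)) q :
  wsum s q = \sum_(j < size q) q`_j * wsum s 'X^j.
Proof.
rewrite /wsum; under [RHS]eq_bigr do rewrite mulr_sumr.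
rewrite exchange_big/=; apply: eq_bigr => wy _.
rewrite horner_coef mulr_sumr; apply: eq_bigr => j _; rewrite hornerXn; ring.
Qed.

(** A rational function with denominator of degree n + 1 and with numerator of
    degree at most n has constant numerator iff it is O(x^-(n+1)) at infinity,
    and its expansion there has the moments as coefficients.  Formally, as long
    as the first j moments vanish, multiplication by X^j only twists the
    weights, and degrees can be compared on both sides. *)
Lemma size_pf_num_le1 (R : idomainType) n (s : seq (R * R)) : size s = n.+1 ->
  (size (pf_num s) <= 1)%N <->
  (forall q : {poly R}, (size q <= n)%N -> wsum s q = 0).
Proof.
move=> ss; have numerX j : (forall i, (i < j)%N -> wsum s 'X^i = 0) ->
    'X^j * pf_num s = pf_num (twist j s).
  elim: j => [|j IH] h.
    rewrite mul1r; congr pf_num; rewrite /twist -[LHS]map_id.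
    by apply: eq_map => -[w y] /=; rewrite expr0 mulr1.
  rewrite exprS -mulrA IH => [|i ij]; last by apply: h; rewrite ltnW.
  by rewrite mulX_pf_num_twist h// mul0r addr0.
split=> [n1 q qn|h].
  rewrite wsum_coef big1// => -[j/= /leq_trans/(_ qn) jn] _.
  suff -> : wsum s 'X^j = 0 by rewrite mulr0.
  elim/ltn_ind: j jn => j IH jn; have {}IH i : (i < j)%N -> wsum s 'X^i = 0.
    by move=> ij; apply: IH => //; apply: ltn_trans jn.
  (* in the coefficients of X^(n+1), the left side has too small a degree and on
     the right only the monic denominator contributes *)
  have /(congr1 (fun p : {poly R} => ('X * p)`_n.+1)) := numerX j IH.
  rewrite mulX_pf_num_twist mulrA -exprS coefXnM ltnNge ltnW//= coefD coefCM.
  rewrite [X in X = _]nth_default; last by rewrite (leq_trans n1)// subn_gt0.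
  rewrite nth_default ?add0r; last first.
    by rewrite (leq_trans (size_pf_num _))// size_map ss.
  suff -> : (pf_den s)`_n.+1 = 1 by rewrite mulr1.
  have := monicP (monic_prod_XsubC s predT snd).
  by rewrite lead_coefE -/(pf_den s) size_pf_den ss.
have /numerX/(congr1 (size : {poly R} -> nat)) : forall i, (i < n)%N -> wsum s 'X^i = 0.
  by move=> i ni; apply: h; rewrite size_polyXn.
have [->|n0] := eqVneq (pf_num s) 0; first by rewrite size_poly0.
rewrite mulrC size_mulXn// => sE; have := size_pf_num (twist n s).
by rewrite -sE size_map ss -addn1 leq_add2l.
Qed.

Lemma pf_num_cat (R : comNzRingType) (s1 s2 : seq (R * R)) :
  pf_num (s1 ++ s2) = pf_num s1 * pf_den s2 + pf_den s1 * pf_num s2.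
Proof.
elim: s1 => [|wy s1 IH]/=; first by rewrite /pf_den big_nil mul0r add0r mul1r.
by rewrite IH pf_den_cons /pf_den big_cat/=; ring.
Qed.

Lemma pf_num_const (R : comNzRingType) (c : R) A :
  pf_num [seq (c, a) | a <- A] = c%:P * (\prod_(a <- A) ('X - a%:P))^`().
Proof.
elim: A => [|a A IH]/=; first by rewrite big_nil derivC mulr0.
by rewrite IH big_cons derivM derivXsubC /pf_den big_map/=; ring.
Qed.

(** * The balance condition as a Wronskian identity *)

Definition balanced (R : comNzRingType) (theta : R) (A B : seq R) :=
  forall q : {poly R}, (size q <= (size A + size B).+1)%N ->
    \sum_(a <- A) (q.[a] - q.[0]) - \sum_(b <- B) (q.[b] - q.[0])
    = theta * (q.[1] - q.[0]).

(** The numerator of a'/a - b'/b - theta / (x - 1) + (theta - (m - n)) / x over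
    the denominator x (x - 1) a b. *)
Definition wronsk (R : comNzRingType) (m n : nat) (theta : R) (a b : {poly R}) :=
  'X * ('X - 1) * (a^`() * b - a * b^`())
  - ((m%:R - n%:R)%:P * ('X - 1) + theta%:P) * (a * b).

(** The weight at 0 is chosen so that the total weight vanishes: the balance
    condition only involves differences q(y) - q(0). *)
Definition pade_nodes (R : comNzRingType) (theta : R) (A B : seq R) :=
  [:: (theta - ((size A)%:R - (size B)%:R), 0), (- theta, 1)
    & [seq (1, a) | a <- A] ++ [seq (- 1, b) | b <- B]].

Lemma wsum_pade_nodes (R : comNzRingType) (theta : R) A B (q : {poly R}) :
  wsum (pade_nodes theta A B) q =
  \sum_(a <- A) (q.[a] - q.[0]) - \sum_(b <- B) (q.[b] - q.[0])
    - theta * (q.[1] - q.[0]).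
Proof.
rewrite /wsum !big_cons big_cat/= !big_map !sumrB -!mulr_sumr !big_const_seq.
rewrite !count_predT !iter_addr_0 -[_ *+ size A]mulr_natr -[_ *+ size B]mulr_natr.
ring.
Qed.

Lemma pf_num_pade_nodes (R : comNzRingType) (theta : R) A B :
  pf_num (pade_nodes theta A B) =
  wronsk (size A) (size B) theta (\prod_(a <- A) ('X - a%:P))
                                 (\prod_(b <- B) ('X - b%:P)).
Proof.
rewrite /= pf_num_cat !pf_num_const pf_den_cons /pf_den big_cat/= !big_map/=.
rewrite /wronsk !(polyCN, polyCB, polyC0, polyC1); ring.
Qed.

Lemma balancedP (R : idomainType) (theta : R) A B :
  balanced theta A B <->
  (size (wronsk (size A) (size B) theta (\prod_(a <- A) ('X - a%:P))
                                (\prod_(b <- B) ('X - b%:P))) <= 1)%N.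
Proof.
rewrite -pf_num_pade_nodes (@size_pf_num_le1 _ (size A + size B).+1); last first.
  by rewrite /= size_cat !size_map.
split=> h q /h; first by rewrite wsum_pade_nodes => ->; rewrite subrr.
by rewrite wsum_pade_nodes => /eqP; rewrite subr_eq0 => /eqP.
Qed.

(** The products a' b' cancel, the terms in a' b and in a b' are absorbed by the
    first-order coefficients of the two operators, and the terms in a b match
    because m (n + 1) - n (m + 1) = m - n. *)
Lemma deriv_wronsk (R : realType) m n (theta : R) (a b : {poly R}) :
  (wronsk m n theta a b)^`() =
  b * hypergeom m n theta a - a * hypergeom n m (- theta) b.
Proof.
rewrite /wronsk /hypergeom -polyC1 !(derivB, derivD, derivM, derivN) derivX !derivC.
rewrite !(polyCB, polyCD, polyCN, polyCM, polyC1, polyC_natr).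
move: a^`()^`() b^`()^`() a^`() b^`() => a2 b2 a1 b1.
ring.
Qed.

Lemma size_le1_deriv (R : realType) (p : {poly R}) :
  (size p <= 1)%N <-> p^`() = 0.
Proof.
split=> [/size1_polyC ->|p0]; first by rewrite derivC.
apply/leq_sizeP => -[//|k] _; apply/eqP; move/polyP/(_ k): p0.
by rewrite coef_deriv coef0 => /eqP; rewrite mulrn_eq0.
Qed.

(** * Balanced lists are disjoint, simple and interlaced *)

Lemma sum_horner_only (R : nzRingType) (q : {poly R}) y (A : seq R) :
  {in A, forall a, a != y -> q.[a] = 0} ->
  \sum_(a <- A) q.[a] = (count_mem y A)%:R * q.[y].
Proof.
elim: A => [|a A IH] qA; first by rewrite big_nil mul0r.
rewrite big_cons /= natrD mulrDl IH => [|b bA]; last by apply: qA; rewrite inE bA orbT.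
congr (_ + _); case: eqVneq => [->|ay]; first by rewrite mul1r.
by rewrite mul0r qA// mem_head.
Qed.

Lemma balanced_only (R : idomainType) (theta : R) A B (q : {poly R}) y :
  balanced theta A B -> (size q <= (size A + size B).+1)%N -> q.[0] = 0 ->
  {in A ++ B, forall a, a != y -> q.[a] = 0} ->
  ((count_mem y A)%:R - (count_mem y B)%:R) * q.[y] = theta * q.[1].
Proof.
move=> bal sq q0 qAB; have := bal q sq; rewrite q0 subr0 => <-.
have subq0 (s : seq R) : \sum_(a <- s) (q.[a] - 0) = \sum_(a <- s) q.[a].
  by apply: eq_bigr => a _; rewrite subr0.
rewrite !subq0.
by rewrite mulrBl !(@sum_horner_only _ q y)// => a aA; apply: qAB; rewrite mem_cat aA ?orbT.
Qed.

(** If two of the n + 2 points coincide, a polynomial of degree at most n can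
    vanish at all of them except 1.  The condition then makes theta equal to
    the multiplicity of 1 in A minus that in B, an integer. *)
Lemma balanced_uniq (R : realType) (theta : R) A B : 0 < theta < 1 ->
  balanced theta A B -> uniq [:: 0, 1 & A ++ B].
Proof.
move=> theta01 bal; rewrite -(negbK (uniq _)) -ltn_size_undup; apply/negP => lts.
set s := [:: 0, 1 & A ++ B] in lts.
pose q : {poly R} := \prod_(v <- rem 1 (undup s)) ('X - v%:P).
have s1 : 1 \in undup s by rewrite mem_undup !inE eqxx orbT.
have sq : (size q <= (size A + size B).+1)%N.
  rewrite size_prod_XsubC size_rem// prednK; last by case: (undup s) s1.
  by move: lts; rewrite /= size_cat.
have q_eq0 v : v \in s -> v != 1 -> q.[v] = 0.
  move=> vs v1; apply/rootP; rewrite root_prod_XsubC.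
  by rewrite mem_rem_uniq ?undup_uniq// inE mem_undup vs v1.
have q0 : q.[0] = 0 by rewrite q_eq0 ?mem_head// eq_sym oner_eq0.
have only1 : {in A ++ B, forall a, a != 1 -> q.[a] = 0}.
  by move=> a aAB a1; rewrite q_eq0// !inE aAB !orbT.
have q1 : q.[1] != 0.
  rewrite -rootE root_prod_XsubC.
  by rewrite mem_rem_uniq ?undup_uniq// !inE eqxx.
have /(mulIf q1) thetaE := balanced_only bal sq q0 only1.
have [le_AB|lt_BA] := leqP (count_mem 1 A) (count_mem 1 B).
  by move: le_AB; rewrite -(ler_nat R); lra.
by move: lt_BA; rewrite -(ler_nat R) -natr1; lra.
Qed.

Lemma sgr_prod_sub (R : realDomainType) (s : seq R) y : y \notin s ->
  Num.sg (\prod_(v <- s) (y - v)) = (-1) ^+ count (> y) s.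
Proof.
elim: s => [|v s IH]; first by rewrite big_nil sgr1.
rewrite inE negb_or big_cons sgrM => /andP[yv /IH ->] /=.
case: ltgtP yv => // h _; first by rewrite ltr0_sg ?subr_lt0// exprS.
by rewrite gtr0_sg ?subr_gt0// mul1r.
Qed.

(** Let q vanish at 0 and at all points but y.  The condition reads
    +-q(y) = theta q(1), where q(1) is a product of positive factors and the
    sign of q(y) is the parity of the number of points above y. *)
Lemma balanced_sign (R : realType) (theta : R) A B y : 0 < theta < 1 ->
  balanced theta A B -> {in A ++ B, forall v, 0 <= v <= 1} -> y \in A ++ B ->
  (count_mem y A)%:R - (count_mem y B)%:R = (-1) ^+ count (> y) (A ++ B) :> R.
Proof.
move=> theta01 bal AB01 yAB; have := balanced_uniq theta01 bal.
rewrite /= !inE negb_or => /and3P[/andP[_ AB0] AB1 uAB].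
set s := rem y (0 :: A ++ B).
have u0 : uniq (0 :: A ++ B) by rewrite /= AB0.
have sE v : (v \in s) = (v != y) && (v \in 0 :: A ++ B) by rewrite mem_rem_uniq.
have y0 : 0 != y by apply: contraNneq AB0 => ->.
pose q : {poly R} := \prod_(v <- s) ('X - v%:P).
have sq : (size q <= (size A + size B).+1)%N.
  by rewrite size_prod_XsubC size_rem ?inE ?yAB ?orbT//= size_cat.
have q_eq0 v : v \in 0 :: A ++ B -> v != y -> q.[v] = 0.
  by move=> vs vy; apply/rootP; rewrite root_prod_XsubC sE vs vy.
have only_y : {in A ++ B, forall a, a != y -> q.[a] = 0}.
  by move=> a aAB ay; rewrite q_eq0// inE aAB orbT.
have qE z : q.[z] = \prod_(v <- s) (z - v).
  by rewrite horner_prod; apply: eq_bigr => v _; rewrite hornerXsubC.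
have q1 : 0 < q.[1].
  rewrite qE big_seq; apply: prodr_gt0 => v.
  rewrite sE inE subr_gt0 lt_neqAle => /andP[_ /predU1P[->|vAB]].
    by rewrite eq_sym oner_eq0 ler01.
  by case/andP: (AB01 v vAB) => _ ->; rewrite andbT; apply: contraNneq AB1 => <-.
have := balanced_only bal sq (q_eq0 0 (mem_head _ _) y0) only_y.
move/(congr1 Num.sg); rewrite !sgrM (gtr0_sg q1) (@gtr0_sg _ theta) ?mulr1;
  last by case/andP: theta01.
rewrite qE sgr_prod_sub ?sE ?eqxx//.
have -> : count (> y) s = count (> y) (A ++ B).
  rewrite count_rem /= ltxx andbF subn0 ltNge.
  by case/andP: (AB01 y yAB) => -> _.
have : (count_mem y A + count_mem y B = 1)%N.
  by rewrite -count_cat count_uniq_mem// yAB.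
move: (count_mem y A) (count_mem y B) => [|[|cA]] [|[|cB]]//= _.
  by rewrite sub0r sgrN sgr1 mulN1r => /eqP; rewrite eqr_oppLR => /eqP ->.
by rewrite subr0 sgr1 mul1r.
Qed.

Lemma balanced_parity (R : realType) (theta : R) A B y : 0 < theta < 1 ->
  balanced theta A B -> {in A ++ B, forall v, 0 <= v <= 1} -> y \in A ++ B ->
  (y \in A) = ~~ odd (count (> y) (A ++ B)).
Proof.
move=> theta01 bal AB01 yAB.
have := balanced_uniq theta01 bal; rewrite !cons_uniq => /and3P[_ _ uAB].
have := balanced_sign theta01 bal AB01 yAB; rewrite -signr_odd.
move: uAB yAB; rewrite cat_uniq mem_cat => /and3P[uA /hasPn dAB uB].
rewrite !count_uniq_mem//.
have [yB _|_] := boolP (y \in B).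
  by rewrite (negPf (dAB y yB)); case: odd => //=; lra.
by rewrite orbF => ->; case: odd => //=; lra.
Qed.

(** * Balanced lists are the roots of the explicit polynomials *)

Lemma coprimep_prod_XsubC (R : idomainType) (p : {poly R}) (s : seq R) :
  {in s, forall b, ~~ root p b} -> coprimep p (\prod_(b <- s) ('X - b%:P)).
Proof.
move=> ps; rewrite big_seq; apply: (big_rec (coprimep p)) => [|b q bs pq].
  exact: coprimep1.
by rewrite coprimepMr pq andbT coprimep_XsubC ps.
Qed.

(** The operator lowers the degree of a polynomial of degree m, because the
    coefficient of X^m in the image carries the factor m - m. *)
Lemma dvdp_hypergeom_eq0 (R : realType) m n (theta : R) (a : {poly R}) :
  size a = m.+1 -> a %| hypergeom m n theta a -> hypergeom m n theta a = 0.
Proof.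
move=> sa aL; apply/eqP; apply: contraTT aL => L0; apply/negP => /(dvdp_leq L0).
apply/negP; rewrite -ltnNge sa ltnS; apply/leq_sizeP => k mk.
rewrite coef_hypergeom (@nth_default _ _ _ k.+1) ?sa// mulr0 subr0.
move: mk; rewrite leq_eqVlt => /predU1P[<-|mk]; first by rewrite subrr !mul0r.
by rewrite nth_default ?mulr0 ?sa.
Qed.

(** From b L(a) = a L'(b) and coprimality, a divides L(a) and b divides L'(b). *)
Lemma pade_of_balanced (R : realType) (theta : R) A B : uniq (A ++ B) ->
  balanced theta A B ->
  \prod_(a <- A) ('X - a%:P) = pade_poly (size A) (size B) theta
  /\ \prod_(b <- B) ('X - b%:P) = pade_poly (size B) (size A) (- theta).
Proof.
rewrite cat_uniq => /and3P[_ /hasPn dAB _] /balancedP /size_le1_deriv.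
set a := \prod_(_ <- A) _; set b := \prod_(_ <- B) _.
have cab : coprimep a b.
  by apply: coprimep_prod_XsubC => y /dAB; rewrite root_prod_XsubC.
rewrite deriv_wronsk => /eqP; rewrite subr_eq0 => /eqP W0.
have sa : size a = (size A).+1 by rewrite size_prod_XsubC.
have sb : size b = (size B).+1 by rewrite size_prod_XsubC.
split; apply: hypergeom_monic_unique => //; rewrite ?monic_prod_XsubC//;
  apply: dvdp_hypergeom_eq0 => //.
  by rewrite -(Gauss_dvdpr _ cab) W0 dvdp_mulr.
by rewrite -(@Gauss_dvdpr _ _ a) 1?coprimep_sym// -W0 dvdp_mulr.
Qed.

Lemma balanced_of_pade (R : realType) (theta : R) A B :
  \prod_(a <- A) ('X - a%:P) = pade_poly (size A) (size B) theta ->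
  \prod_(b <- B) ('X - b%:P) = pade_poly (size B) (size A) (- theta) ->
  balanced theta A B.
Proof.
move=> aE bE; apply/balancedP/size_le1_deriv.
by rewrite deriv_wronsk aE bE !hypergeom_pade_poly !mulr0 subr0.
Qed.

(** * The nodes *)

Lemma map_node (R : realType) n (x : n.-tuple R) :
  [seq node x i | i <- iota 1 n] = x.
Proof.
apply: (@eq_from_nth _ 1) => [|i]; rewrite size_map size_iota ?size_tuple// => ni.
by rewrite (nth_map 0%N) ?size_iota// nth_iota.
Qed.

Lemma nodes_perm (R : realType) n (x : n.-tuple R) :
  perm_eq (nodes_even x ++ nodes_odd x) x.
Proof.
rewrite -[X in perm_eq _ X]map_node /nodes_even /nodes_odd -map_cat.
by apply: perm_map; rewrite perm_catC perm_filterC.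
Qed.

(** Passing from n to n + 1 exchanges the two parities of n - i and adds the
    index n + 1 to the even ones; hence both sizes are treated together. *)
Lemma size_nodes (R : realType) n (x : n.-tuple R) :
  size (nodes_even x) = uphalf n /\ size (nodes_odd x) = n./2.
Proof.
rewrite !size_map !size_filter; elim: n {x} => [//|n [IHe IHo]].
have cS (p : bool -> bool) : count (fun i => p (odd (n.+1 - i))) (iota 1 n) =
    count (fun i => p (~~ odd (n - i))) (iota 1 n).
  by apply: eq_in_count => i; rewrite mem_iota => i_le; rewrite subSn ?oddS//; lia.
rewrite -addn1 iotaD !count_cat /= add1n addn1 subnn/= !addn0.
rewrite (cS negb) (cS id) IHe; split=> //.
by rewrite (eq_count (fun i => negbK _)) IHo addn1.
Qed.

Lemma sum_nodes (R : realType) n (x : n.-tuple R) (g : R -> R) :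
  \sum_(a <- nodes_even x) g a - \sum_(b <- nodes_odd x) g b =
  \sum_(1 <= i < n.+1) (-1) ^+ (n - i) * g (node x i).
Proof.
rewrite !big_map !big_filter /index_iota subSS subn0.
rewrite [in X in X - _]big_mkcond [in X in _ - X]big_mkcond -sumrB.
apply: eq_bigr => i _; rewrite -signr_odd; case: odd => /=.
  by rewrite sub0r mulN1r.
by rewrite subr0 mul1r.
Qed.

Lemma Delta_sorted (R : realType) n (x : n.-tuple R) : Delta x ->
  sorted <=%R x /\ {in x, forall v, 0 <= v <= 1}.
Proof.
move=> xD; split.
  by move: xD; rewrite /Delta/= rcons_path => /andP[/path_sorted].
move=> v /(nthP 1)[i]; rewrite size_tuple => ni <-.
have nE : nth 1 x i = node x i.+1 by [].
have n0 : node x 0 = 0 by [].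
have n1 : node x n.+1 = 1 by rewrite /node /= nth_default ?size_tuple.
have i1 : (i < n.+1)%N by rewrite ltnS ltnW.
rewrite nE; apply/andP; split; first by rewrite -n0 node_le.
by rewrite -n1 node_le// i1 leqnn.
Qed.

(** For distinct nodes, n - i is the number of nodes above x_i, so the two
    sublists can be recognized without reference to indices. *)
Lemma nodes_filter (R : realType) n (x : n.-tuple R) : Delta x -> uniq x ->
  nodes_even x = [seq y <- x | ~~ odd (count (> y) x)]
  /\ nodes_odd x = [seq y <- x | odd (count (> y) x)].
Proof.
move=> /Delta_sorted[xs _] xu.
have ltx : sorted <%O (x : seq R) by rewrite lt_sorted_uniq_le xu.
have cE i : i \in iota 1 n -> (n - i)%N = count (> node x i) x.
  rewrite mem_iota; case: i => [//|i] /andP[_ ni].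
  rewrite -[node x i.+1]/(nth 1 x i).
  have := count_predC (<= nth 1 x i) x; rewrite size_tuple.
  rewrite count_le_nth ?size_tuple// => nE; rewrite -[in LHS]nE addKn.
  by apply: eq_count => v /=; rewrite ltNge.
rewrite -[in X in _ = X /\ _](map_node x) -[in X in _ /\ _ = X](map_node x).
rewrite !filter_map; split; congr map; apply: eq_in_filter => i /cE nE /=;
  by rewrite nE map_node.
Qed.

(** * The pairing as an alternating sum *)

Local Open Scope classical_set_scope.

Lemma Rintegral_horner_deriv (R : realType) (q : {poly R}) (a b : R) : a <= b ->
  \int[@lebesgue_measure R]_(t in `[a, b]) q^`().[t] = q.[b] - q.[a].
Proof.
rewrite le_eqVlt => /predU1P[->|ab].
  by rewrite set_itv1 Rintegral_set1 subrr.
rewrite /Rintegral (@continuous_FTC2 _ _ (horner q))//.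
- by apply: continuous_subspaceT; exact: continuous_horner.
- split=> [x _||].
  + exact: derivable_horner.
  + by apply: cvg_at_right_filter; exact: continuous_horner.
  + by apply: cvg_at_left_filter; exact: continuous_horner.
by move=> x _; rewrite derivE.
Qed.

(** Continuity on the whole segment gives integrability on any part of it. *)
Lemma integrable_horner (R : realType) (p : {poly R}) (D : set R) :
  measurable D -> D `<=` `[0, 1] ->
  (@lebesgue_measure R).-integrable D (EFin \o horner p).
Proof.
move=> mD D01; apply: (@integrableS _ _ _ lebesgue_measure `[0,1] D) => //.
apply: continuous_compact_integrable; first exact: segment_compact.
by apply: continuous_subspaceT; exact: continuous_horner.
Qed.

(** Integrability and value are carried together so that a finite sum can be
    integrated termwise by induction. *)
Definition has_Rintegral (R : realType) (f : R -> R) (v : R) :=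
  (@lebesgue_measure R).-integrable `[0, 1] (EFin \o f) /\
  \int[@lebesgue_measure R]_(t in `[0, 1]) f t = v.

Lemma has_RintegralD (R : realType) (f g : R -> R) (u v : R) :
  has_Rintegral f u -> has_Rintegral g v -> has_Rintegral (f \+ g) (u + v).
Proof.
move=> [fi <-] [gi <-]; split; last exact: RintegralD.
exact: (@integrableD _ _ _ lebesgue_measure `[0, 1] _ _ _ fi gi).
Qed.

Lemma has_Rintegral_indic (R : realType) (p : {poly R}) (c : R) (A : set R) :
  measurable A -> A `<=` `[0, 1] ->
  has_Rintegral (fun t => c * \1_A t * p.[t])
                (c * \int[@lebesgue_measure R]_(t in A) p.[t]).
Proof.
move=> mA A01; have iA := integrable_horner p mA A01.
have E : (fun t => c * \1_A t * p.[t]) = (fun t => c * (horner p \_ A) t).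
  apply/funext => t; rewrite -mulrA; congr (_ * _); rewrite indicE patchE.
  by case: ifPn => _; rewrite ?mul1r ?mul0r.
have iAr : (@lebesgue_measure R).-integrable `[0, 1] (EFin \o (horner p \_ A)).
  rewrite -restrict_EFin; apply/integrable_restrict => //.
  by rewrite setIC setIidl.
rewrite E; split.
  exact: (@integrableZl _ _ _ lebesgue_measure `[0, 1] _ c _ iAr).
by rewrite RintegralZl// -Rintegral_mkcondr setIC setIidl.
Qed.

(** Sigma - lambda is, on [0, 1], a combination of the indicators of the
    intervals [x_m, x_(m+1)[, of {1} and of [0, 1]; the fundamental theorem of
    calculus applies on each piece and {1} is negligible. *)
Lemma pairing_deriv_Sigma (R : realType) n (x : n.-tuple R) (lambda : R) q :
  Delta x ->
  pairing (fun t : R => q^`().[t]) (fun t : R => Sigma x t - lambda) =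
  \sum_(m < n.+1) (-1) ^+ m * (q.[node x m.+1] - q.[node x m])
  - lambda * (q.[1] - q.[0]).
Proof.
move=> xD; have node0 : node x 0 = 0 by [].
have node1 : node x n.+1 = 1 by rewrite /node /= nth_default ?size_tuple.
have le_node (m : 'I_n.+1) :
    [/\ 0 <= node x m, node x m <= node x m.+1 & node x m.+1 <= 1].
  split; first by apply: (@node_le R n x 0 m xD); rewrite leq0n /= ltnW.
    by apply: node_le => //; rewrite leqnSn ltn_ord.
  by rewrite -[leRHS]node1; apply: node_le => //; rewrite ltn_ord leqnn.
pose I (m : nat) : set R := `[node x m, node x m.+1[.
have mI m : measurable (I m) by exact: measurable_itv.
have I01 (m : 'I_n.+1) : I m `<=` `[0, 1].
  case: (le_node m) => n0 _ n1 t /=; rewrite !in_itv/= => /andP[mt tm].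
  by rewrite (le_trans n0 mt) (ltW (lt_le_trans tm n1)).
have sumI : has_Rintegral
    (\sum_(m < n.+1) (fun t => (-1) ^+ m * \1_(I m) t * q^`().[t]))
    (\sum_(m < n.+1) (-1) ^+ m * (q.[node x m.+1] - q.[node x m])).
  apply: (big_rec2 (@has_Rintegral R)) => [|m v f _ IH].
    split; first exact: (@integrable0 _ _ _ lebesgue_measure).
    by rewrite /Rintegral integral0.
  apply: has_RintegralD IH; case: (le_node m) => _ mn _.
  rewrite -Rintegral_horner_deriv// -Rintegral_itv_bndo_bndc.
    exact: (has_Rintegral_indic _ _ (mI m) (I01 m)).
  exact: (integrable_horner _ (mI m) (I01 m)).
have sub1 : [set 1] `<=` (`[0, 1] : set R).
  by move=> _ -> /=; rewrite in_itv/= ler01 lexx.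
have sum1 := has_Rintegral_indic q^`() ((-1) ^+ n) (measurable_set1 1) sub1.
have suml := has_Rintegral_indic q^`() (- lambda) (measurable_itv `[0, 1]%R)
  (@subset_refl _ `[0, 1]).
have [_] := has_RintegralD (has_RintegralD sumI sum1) suml.
rewrite Rintegral_set1 mulr0 addr0 Rintegral_horner_deriv ?ler01// mulNr => <-.
apply: eq_Rintegral => t t01 /=; rewrite fct_sumE.
rewrite [\1_(_ `[0, 1]) t]indicE t01 /Sigma mulr1 mulrBl mulrDl mulr_suml mulNr.
by [].
Qed.

Local Close Scope classical_set_scope.

(** Abel summation: each interior value is met twice, with the same sign. *)
Lemma alternating_sum (R : comNzRingType) (f : nat -> R) n :
  (-1) ^+ n * (\sum_(m < n.+1) (-1) ^+ m * (f m.+1 - f m)) =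
  (f n.+1 - f 0%N) - (\sum_(1 <= i < n.+1) (-1) ^+ (n - i) * (f i - f 0%N)) *+ 2.
Proof.
elim: n => [|n IH]; first by rewrite big_ord1 big_geq// expr0 !mul1r mul0rn subr0.
rewrite big_ord_recr mulrDr mulrA -exprMn mulrNN mulr1 expr1n mul1r.
rewrite exprS -mulrA IH [in RHS]big_nat_recr//= subnn expr0 mul1r.
rewrite [in RHS](eq_big_nat _ _ (F2 := fun i => - ((-1) ^+ (n - i) * (f i - f 0%N)))).
  by rewrite sumrN; ring.
by move=> i /andP[_ i_le]; rewrite subSn// exprS mulN1r mulNr.
Qed.

Lemma antiderivative (R : realType) n (p : {poly R}) : (size p <= n)%N ->
  exists2 q : {poly R}, (size q <= n.+1)%N & q^`() = p.
Proof.
move=> sp; exists (\poly_(i < n.+1) (p`_i.-1 / i%:R)); first exact: size_poly.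
apply/polyP => k; rewrite coef_deriv coef_poly ltnS.
case: ltnP => [_|nk]; last by rewrite mul0rn nth_default// (leq_trans sp).
by rewrite /= -[LHS]mulr_natr mulfVK// pnatr_eq0.
Qed.

(** Every polynomial is a derivative, and the pairing with q' is, up to the
    factor 2 (-1)^n, the defect in the balance condition for q. *)
Lemma orthogonal_balanced (R : realType) n (x : n.-tuple R) (lambda theta : R) :
  Delta x -> theta = (1 - (-1) ^+ n * lambda) / 2 ->
  (forall p : {poly R}, (size p <= n)%N ->
     pairing (fun t : R => p.[t]) (fun t : R => Sigma x t - lambda) = 0) <->
  balanced theta (nodes_even x) (nodes_odd x).
Proof.
move=> xD thetaE.
have szx : (size (nodes_even x) + size (nodes_odd x) = n)%N.
  by rewrite -size_cat (perm_size (nodes_perm x)) size_tuple.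
have pairE q : (-1) ^+ n *
    pairing (fun t : R => q^`().[t]) (fun t : R => Sigma x t - lambda) =
    (theta * (q.[1] - q.[0]) -
     (\sum_(a <- nodes_even x) (q.[a] - q.[0])
      - \sum_(b <- nodes_odd x) (q.[b] - q.[0]))) * 2.
  rewrite pairing_deriv_Sigma// sum_nodes mulrBr.
  rewrite (alternating_sum (fun i => q.[node x i])) thetaE.
  have -> : node x n.+1 = 1 by rewrite /node /= nth_default ?size_tuple.
  by rewrite -[_ *+ 2]mulr_natr /=; field.
split=> [orth q|bal p].
  rewrite szx => sq; have := pairE q; rewrite orth ?mulr0; last first.
    have [->|q0] := eqVneq q 0; first by rewrite deriv0 size_poly0.
    by rewrite -ltnS (leq_trans (lt_size_deriv q0)).
  by move/esym/eqP; rewrite mulf_eq0 pnatr_eq0 orbF subr_eq0 => /eqP.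
move=> /antiderivative[q sq <-]; have := pairE q; rewrite bal ?szx//.
by rewrite subrr mul0r => /eqP; rewrite mulf_eq0 signr_eq0 => /eqP.
Qed.

Lemma eq_balanced (R : comNzRingType) (theta : R) A B A' B' :
  perm_eq A A' -> perm_eq B B' -> balanced theta A B -> balanced theta A' B'.
Proof.
move=> pA pB bal q; rewrite -(perm_size pA) -(perm_size pB) => /bal.
by rewrite (perm_big _ pA) (perm_big _ pB).
Qed.

(** * Distribution of the roots among the nodes *)

Lemma roots_of_monic (R : realType) (p : {poly R}) s : p \is monic ->
  roots_of p s <-> \prod_(a <- s) ('X - a%:P) = p.
Proof.
move=> pm; rewrite /roots_of eqp_monic ?monic_prod_XsubC//.
by split=> [/eqP|] ->.
Qed.

(** By [balanced_parity], membership in A depends only on the number of points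
    above, and [nodes_even] has the same description. *)
Lemma balanced_nodes (R : realType) n (x : n.-tuple R) (theta : R) A B :
  0 < theta < 1 -> Delta x -> balanced theta A B -> perm_eq (A ++ B) x ->
  perm_eq A (nodes_even x) /\ perm_eq B (nodes_odd x).
Proof.
move=> theta01 xD bal pAB; have [_ x01] := Delta_sorted xD.
have := balanced_uniq theta01 bal; rewrite !cons_uniq => /and3P[_ _ uAB].
have xu : uniq x by rewrite -(perm_uniq pAB).
have AB01 : {in A ++ B, forall v, 0 <= v <= 1}.
  by move=> v; rewrite (perm_mem pAB) => /x01.
have pA : perm_eq A (nodes_even x).
  have [-> _] := nodes_filter xD xu; apply: uniq_perm.
  - by move: uAB; rewrite cat_uniq => /andP[].
  - exact: filter_uniq.
  move=> y; rewrite mem_filter -(perm_mem pAB) -(permP pAB).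
  have [yAB|] := boolP (y \in A ++ B).
    by rewrite (balanced_parity theta01 bal AB01 yAB) andbT.
  by rewrite mem_cat negb_or andbF => /andP[/negPf].
split=> //; rewrite -(perm_cat2l (nodes_even x)).
apply: perm_trans (_ : perm_eq (A ++ B) _); first by rewrite perm_cat2r perm_sym.
by apply: perm_trans pAB _; rewrite perm_sym nodes_perm.
Qed.

(** In the converse direction the roots of the two polynomials are given only as
    a merged list; they are balanced by [balanced_of_pade], and this forces the
    two lists to be the two alternating sublists of nodes. *)
Lemma balanced_joint_roots (R : realType) n (x : n.-tuple R) (theta : R) :
  0 < theta < 1 -> Delta x ->
  let p := pade_poly (uphalf n) n./2 theta in
  let q := pade_poly n./2 (uphalf n) (- theta) in
  (balanced theta (nodes_even x) (nodes_odd x) <-> joint_roots p q x) /\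
  (balanced theta (nodes_even x) (nodes_odd x) ->
     roots_of p (nodes_even x) /\ roots_of q (nodes_odd x)).
Proof.
move=> theta01 xD p q; have [sE sO] := size_nodes x.
have rootsE N e (t : R) s : roots_of (pade_poly N e t) s <->
    \prod_(a <- s) ('X - a%:P) = pade_poly N e t.
  exact/roots_of_monic/monic_pade_poly.
have size_roots N e (t : R) s : roots_of (pade_poly N e t) s -> size s = N.
  move=> /rootsE sP; apply: succn_inj.
  by rewrite -(size_prod_XsubC s id) sP size_pade_poly.
have rootsAB : balanced theta (nodes_even x) (nodes_odd x) ->
    roots_of p (nodes_even x) /\ roots_of q (nodes_odd x).
  move=> bal; rewrite !rootsE -sE -sO; apply: pade_of_balanced => //.
  by have := balanced_uniq theta01 bal; rewrite !cons_uniq => /and3P[].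
split=> //; split=> [bal|[sp [sq [spP sqP xE]]]].
  have [pA qB] := rootsAB bal; exists (nodes_even x), (nodes_odd x); split=> //.
  have [xs _] := Delta_sorted xD.
  rewrite -[LHS](sort_le_id xs); apply/perm_sort_leP.
  by rewrite perm_sym nodes_perm.
have bal : balanced theta sp sq.
  apply: balanced_of_pade; rewrite (size_roots _ _ _ _ spP) (size_roots _ _ _ _ sqP).
    exact/rootsE.
  exact/rootsE.
have px : perm_eq (sp ++ sq) x by rewrite xE perm_sym perm_sort.
have [pA pB] := balanced_nodes theta01 xD bal px.
exact: eq_balanced pA pB bal.
Qed.

Lemma Ppoly_pade (R : realType) m (theta : R) : Ppoly m theta = pade_poly m m theta.
Proof. by rewrite /Ppoly mul2n -addnn. Qed.

Lemma Qpoly_pade (R : realType) m (theta : R) :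
  Qpoly m theta = pade_poly m.+1 m theta.
Proof. by rewrite /Qpoly /pade_poly mul2n -addnn addn1 -addSn addn1. Qed.

Lemma Rpoly_pade (R : realType) m (theta : R) :
  Rpoly m theta = pade_poly m m.+1 theta.
Proof. by rewrite /Rpoly /pade_poly mul2n -addnn !addn1 -addnS. Qed.

Unset Implicit Arguments.

Theorem theorem4p6 (R : realType) (lambda : R) (n : nat) (x : n.-tuple R)
    (hlambda : -1 < lambda < 1) (hn : (1 <= n)%N) (hx : Delta x) :
  let orthogonal := forall p : {poly R}, (size p <= n)%N ->
    pairing (fun t : R => p.[t]) (fun t : R => Sigma x t - lambda) = 0 in
  (forall m : nat, n = (2 * m)%N ->
     let theta := (1 - lambda) / 2 in
     (orthogonal <-> joint_roots (Ppoly m theta) (Ppoly m (- theta)) x)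
     /\ (orthogonal ->
           roots_of (Ppoly m theta) (nodes_even x)
           /\ roots_of (Ppoly m (- theta)) (nodes_odd x)))
  /\
  (forall m : nat, n = (2 * m + 1)%N ->
     let theta := (1 + lambda) / 2 in
     (orthogonal <-> joint_roots (Qpoly m theta) (Rpoly m (- theta)) x)
     /\ (orthogonal ->
           roots_of (Qpoly m theta) (nodes_even x)
           /\ roots_of (Rpoly m (- theta)) (nodes_odd x))).
Proof.
move=> orthogonal; split=> m nE theta.
- have theta01 : 0 < theta < 1 by rewrite /theta; lra.
  have thetaE : theta = (1 - (-1) ^+ n * lambda) / 2.
    by rewrite nE exprM sqrrN !expr1n mul1r.
  have orthE : orthogonal <-> _ := orthogonal_balanced hx thetaE.
  have := balanced_joint_roots theta01 hx; rewrite !Ppoly_pade.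
  have -> : uphalf n = m by lia.
  have -> : n./2 = m by lia.
  move=> [jointE rootsAB]; split; first exact: iff_trans orthE jointE.
  by move=> /orthE /rootsAB.
- have theta01 : 0 < theta < 1 by rewrite /theta; lra.
  have thetaE : theta = (1 - (-1) ^+ n * lambda) / 2.
    by rewrite nE exprD exprM sqrrN !expr1n mul1r expr1 mulN1r opprK.
  have orthE : orthogonal <-> _ := orthogonal_balanced hx thetaE.
  have := balanced_joint_roots theta01 hx; rewrite Qpoly_pade Rpoly_pade.
  have -> : uphalf n = m.+1 by lia.
  have -> : n./2 = m by lia.
  move=> [jointE rootsAB]; split; first exact: iff_trans orthE jointE.
  by move=> /orthE /rootsAB.
Qed.
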